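(* Let $\mathbf{C}$ be a right rigid monoidal category with unit object $\mathbf{1}$. Let $\mathrm{TId}(\mathbf{C})$ be the set of left-tensor ideals in $\mathbf{C}$, partially ordered by inclusion, and let $\mathrm{Sub}_{\mathbf{C}}(\mathscr{P}_{\mathbf 1})$ be the set of subfunctors (submodules) of the additive functor $\mathscr{P}_{\mathbf 1}=\mathbf{C}(\mathbf{1},-):\mathbf{C}\to\mathbf{Ab}$, partially ordered by inclusion. Then the assignment $$\Psi:\mathrm{TId}(\mathbf{C})\to\mathrm{Sub}_{\mathbf{C}}(\mathscr{P}_{\mathbf 1}),\qquad \mathcal{J}\mapsto\mathcal{J}(\mathbf{1},-),$$ is an isomorphism of partially ordered sets.
   Context: Categories are essentially small. A monoidal category means a preadditive category $\mathbf{C}$ with a bi-additive functor $\otimes:\mathbf{C}\times\mathbf{C}\to\mathbf{C}$ and unit $\mathbf 1$ satisfying the usual axioms (it may be taken strict). A right dual of an object $X$ is a triple $(X^\vee,\mathrm{ev}_X,\mathrm{co}_X)$ with $\mathrm{ev}_X:X\otimes X^\vee\to\mathbf 1$ and $\mathrm{co}_X:\mathbf 1\to X^\vee\otimes X$ such that $(\mathrm{ev}_X\otimes 1_X)\circ(1_X\otimes\mathrm{co}_X)=1_X$ and $(1_{X^\vee}\otimes\mathrm{ev}_X)\circ(\mathrm{co}_X\otimes 1_{X^\vee})=1_{X^\vee}$. $\mathbf{C}$ is right rigid if every object has a right dual. An ideal $\mathcal{J}$ in $\mathbf{C}$ consists of subgroups $\mathcal{J}(X,Y)\subset\mathbf{C}(X,Y)$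 for all objects $X,Y$, closed under pre- and post-composition with arbitrary morphisms of $\mathbf C$. A left-tensor ideal is an ideal such that $f\in\mathcal{J}(X,Y)$ implies $1_Z\otimes f\in\mathcal{J}(Z\otimes X,Z\otimes Y)$ for all objects $Z$. For an ideal $\mathcal J$, $\mathcal{J}(\mathbf 1,-)$ is the subfunctor of $\mathbf{C}(\mathbf 1,-)$ sending $X$ to $\mathcal{J}(\mathbf 1,X)$. $\mathbf{Ab}$ is the category of abelian groups. *)

(* Defs.v *)
From HB Require Import structures.
From mathcomp Require Import all_boot all_order all_algebra.
From mathcomp Require Import boolp classical_sets.

Set Implicit Arguments.
Unset Strict Implicit.
Unset Printing Implicit Defensive.

Import Order.TTheory GRing.Theory.
Local Open Scope ring_scope.
Local Open Scope classical_set_scope.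

Declare Scope cat_scope.
Delimit Scope cat_scope with cat.
Local Open Scope cat_scope.

(* The choice structure carried by a [zmodType] is no restriction: it exists
   classically on any abelian group. *)
Record preadditive := Preadditive {
  obj :> Type;
  mor : obj -> obj -> zmodType;
  idm : forall X, mor X X;
  mcomp : forall X Y Z, mor Y Z -> mor X Y -> mor X Z;
  mcompA : forall X Y Z W (h : mor Z W) (g : mor Y Z) (f : mor X Y),
    mcomp h (mcomp g f) = mcomp (mcomp h g) f;
  mcomp1m : forall X Y (f : mor X Y), mcomp (idm Y) f = f;
  mcompm1 : forall X Y (f : mor X Y), mcomp f (idm X) = f;
  mcompDl : forall X Y Z (g g' : mor Y Z) (f : mor X Y),
    mcomp (g + g') f = mcomp g f + mcomp g' f;
  mcompDr : forall X Y Z (g : mor Y Z) (f f' : mor X Y),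
    mcomp g (f + f') = mcomp g f + mcomp g f'
}.

Arguments mor {p} X Y.
Arguments idm {p} X.
Arguments mcomp {p X Y Z} g f.

Notation "g ∘ f" := (mcomp g f) (at level 40, left associativity) : cat_scope.

Reserved Notation "X ⊗ Y" (at level 35, right associativity).
Reserved Notation "f ⊠ g" (at level 35, right associativity).

(* [⊗] acts on objects and [⊠] on morphisms. *)
Record monoidal := Monoidal {
  mcat :> preadditive;
  unit1 : mcat;
  tens : mcat -> mcat -> mcat
    where "X ⊗ Y" := (tens X Y);
  tensm : forall X X' Y Y' : mcat,
    mor X X' -> mor Y Y' -> mor (X ⊗ Y) (X' ⊗ Y')
    where "f ⊠ g" := (tensm f g);
  tensm1 : forall X Y : mcat, idm X ⊠ idm Y = idm (X ⊗ Y);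
  tensmM : forall (X X' X'' Y Y' Y'' : mcat)
      (f' : mor X' X'') (f : mor X X') (g' : mor Y' Y'') (g : mor Y Y'),
    (f' ∘ f) ⊠ (g' ∘ g) = (f' ⊠ g') ∘ (f ⊠ g);
  tensmDl : forall (X X' Y Y' : mcat) (f f' : mor X X') (g : mor Y Y'),
    (f + f') ⊠ g = f ⊠ g + f' ⊠ g;
  tensmDr : forall (X X' Y Y' : mcat) (f : mor X X') (g g' : mor Y Y'),
    f ⊠ (g + g') = f ⊠ g + f ⊠ g';
  assoc : forall X Y Z : mcat, mor ((X ⊗ Y) ⊗ Z) (X ⊗ (Y ⊗ Z));
  associ : forall X Y Z : mcat, mor (X ⊗ (Y ⊗ Z)) ((X ⊗ Y) ⊗ Z);
  assocK : forall X Y Z : mcat, associ X Y Z ∘ assoc X Y Z = idm _;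
  associK : forall X Y Z : mcat, assoc X Y Z ∘ associ X Y Z = idm _;
  assoc_nat : forall (X X' Y Y' Z Z' : mcat)
      (f : mor X X') (g : mor Y Y') (h : mor Z Z'),
    assoc X' Y' Z' ∘ ((f ⊠ g) ⊠ h) = (f ⊠ (g ⊠ h)) ∘ assoc X Y Z;
  lunit : forall X : mcat, mor (unit1 ⊗ X) X;
  luniti : forall X : mcat, mor X (unit1 ⊗ X);
  lunitK : forall X : mcat, luniti X ∘ lunit X = idm _;
  lunitiK : forall X : mcat, lunit X ∘ luniti X = idm _;
  lunit_nat : forall (X Y : mcat) (f : mor X Y),
    lunit Y ∘ (idm unit1 ⊠ f) = f ∘ lunit X;
  runit : forall X : mcat, mor (X ⊗ unit1) X;
  runiti : forall X : mcat, mor X (X ⊗ unit1);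
  runitK : forall X : mcat, runiti X ∘ runit X = idm _;
  runitiK : forall X : mcat, runit X ∘ runiti X = idm _;
  runit_nat : forall (X Y : mcat) (f : mor X Y),
    runit Y ∘ (f ⊠ idm unit1) = f ∘ runit X;
  triangle : forall X Y : mcat,
    (idm X ⊠ lunit Y) ∘ assoc X unit1 Y = runit X ⊠ idm Y;
  pentagon : forall W X Y Z : mcat,
    assoc W X (Y ⊗ Z) ∘ assoc (W ⊗ X) Y Z =
    (idm W ⊠ assoc X Y Z) ∘ assoc W (X ⊗ Y) Z ∘ (assoc W X Y ⊠ idm Z)
}.

Arguments unit1 {m}.
Arguments tens {m} X Y.
Arguments tensm {m X X' Y Y'} f g.
Arguments assoc {m} X Y Z.
Arguments associ {m} X Y Z.
Arguments lunit {m} X.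
Arguments luniti {m} X.
Arguments runit {m} X.
Arguments runiti {m} X.

Notation "X ⊗ Y" := (tens X Y) : cat_scope.
Notation "f ⊠ g" := (tensm f g) : cat_scope.
Notation "𝟙" := unit1 : cat_scope.

Section RightDual.
Variable C : monoidal.

(* The two triangle identities, with the coherence isomorphisms that are
   implicit in the strict case written out. *)
Record right_dual (X : C) := RightDual {
  dual : C;
  ev : mor (X ⊗ dual) 𝟙;
  co : mor 𝟙 (dual ⊗ X);
  ev_co :
    lunit X ∘ (ev ⊠ idm X) ∘ associ X dual X ∘ (idm X ⊠ co) ∘ runiti X
    = idm X;
  co_ev :
    runit dual ∘ (idm dual ⊠ ev) ∘ assoc dual X dual ∘ (co ⊠ idm dual)
      ∘ luniti dual
    = idm dual
}.

Definition right_rigid : Prop := forall X : C, inhabited (right_dual X).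

End RightDual.

Record ideal (C : preadditive) := Ideal {
  ideal_set :> forall X Y : C, set (mor X Y);
  ideal_zmod : forall X Y, zmod_closed [in @ideal_set X Y];
  ideal_compl : forall (X Y Z : C) (g : mor Y Z) (f : mor X Y),
    @ideal_set X Y f -> @ideal_set X Z (g ∘ f);
  ideal_compr : forall (X Y Z : C) (f : mor Y Z) (h : mor X Y),
    @ideal_set Y Z f -> @ideal_set X Z (f ∘ h)
}.

Arguments ideal_set {C} i X Y.

Record TId (C : monoidal) := LeftTensorIdeal {
  tid_ideal :> ideal C;
  tid_tens : forall (X Y Z : C) (f : mor X Y),
    tid_ideal X Y f -> tid_ideal (Z ⊗ X) (Z ⊗ Y) (idm Z ⊠ f)
}.

(* Additive functors from [C] to abelian groups. *)
Record abfunctor (C : preadditive) := AbFunctor {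
  fobj :> C -> zmodType;
  fmap : forall X Y : C, mor X Y -> {additive fobj X -> fobj Y};
  fmap1 : forall (X : C) x, fmap (idm X) x = x;
  fmapM : forall (X Y Z : C) (g : mor Y Z) (f : mor X Y) x,
    fmap (g ∘ f) x = fmap g (fmap f x);
  fmapD : forall (X Y : C) (f g : mor X Y) x,
    fmap (f + g) x = fmap f x + fmap g x
}.

(* A subfunctor is a family of subgroups stable under the functorial action,
   i.e. a subobject with its canonical representative. *)
Record subfunctor (C : preadditive) (F : abfunctor C) := Subfunctor {
  sub_set :> forall X : C, set (F X);
  sub_zmod : forall X, zmod_closed [in @sub_set X];
  sub_fmap : forall (X Y : C) (f : mor X Y) (x : F X),
    @sub_set X x -> @sub_set Y (fmap F f x)
}.

Arguments sub_set {C F} s X.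

Section Representable.
Variables (C : preadditive) (A : C).

Definition postcomp (X Y : C) (f : mor X Y) (x : mor A X) : mor A Y := f ∘ x.

Lemma postcomp_zmod_morphism (X Y : C) (f : mor X Y) :
  zmod_morphism (postcomp f).
Proof. by move=> x y; apply: (addIr (f ∘ y)); rewrite -mcompDr !subrK. Qed.

HB.instance Definition _ (X Y : C) (f : mor X Y) :=
  GRing.isZmodMorphism.Build (mor A X) (mor A Y) (postcomp f)
    (postcomp_zmod_morphism f).

Definition representable : abfunctor C := {|
  fobj := fun X => mor A X;
  fmap := fun X Y f => postcomp f : {additive mor A X -> mor A Y};
  fmap1 := fun X x => mcomp1m x;
  fmapM := fun X Y Z g f x => esym (mcompA g f x);
  fmapD := fun X Y f g x => mcompDl f g x
|}.

End Representable.

Section Orders.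

Definition tid_le (C : monoidal) (I J : TId C) : bool :=
  `[< forall X Y : C, I X Y `<=` J X Y >].

Definition sub_le (C : preadditive) (F : abfunctor C) (M N : subfunctor F) : bool :=
  `[< forall X : C, M X `<=` N X >].

Variables (C : monoidal) (D : preadditive) (F : abfunctor D).

Lemma tid_le_refl : reflexive (@tid_le C).
Proof. by move=> I; apply/asboolP => X Y f. Qed.

Lemma tid_le_trans : transitive (@tid_le C).
Proof.
move=> J I K /asboolP IJ /asboolP JK; apply/asboolP => X Y.
exact: subset_trans (IJ X Y) (JK X Y).
Qed.

Lemma tid_le_anti : antisymmetric (@tid_le C).
Proof.
move=> I J /andP[/asboolP IJ /asboolP JI].
have E : ideal_set I = ideal_set J.
  by apply: functional_extensionality_dep => X;
     apply: functional_extensionality_dep => Y; apply/seteqP; split.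
case: I J E {IJ JI} => [[I a b c] d] [[J a' b' c'] d'] /= E.
case: J / E in a' b' c' d' *.
rewrite (Prop_irrelevance a' a) (Prop_irrelevance b' b) in d' *.
rewrite (Prop_irrelevance c' c) in d' *.
by rewrite (Prop_irrelevance d' d).
Qed.

Lemma sub_le_refl : reflexive (@sub_le D F).
Proof. by move=> M; apply/asboolP => X x. Qed.

Lemma sub_le_trans : transitive (@sub_le D F).
Proof.
move=> N M P /asboolP MN /asboolP NP; apply/asboolP => X.
exact: subset_trans (MN X) (NP X).
Qed.

Lemma sub_le_anti : antisymmetric (@sub_le D F).
Proof.
move=> M N /andP[/asboolP MN /asboolP NM].
have E : sub_set M = sub_set N.
  by apply: functional_extensionality_dep => X; apply/seteqP; split.
case: M N E {MN NM} => [M a b] [N a' b'] /= E.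
case: N / E in a' b' *.
by rewrite (Prop_irrelevance a' a) (Prop_irrelevance b' b).
Qed.

HB.instance Definition _ := gen_eqMixin (TId C).
HB.instance Definition _ := gen_choiceMixin (TId C).
HB.instance Definition _ := Order.Le_isPOrder.Build (Order.Disp tt tt) (TId C)
  tid_le_refl tid_le_anti tid_le_trans.

HB.instance Definition _ := gen_eqMixin (subfunctor F).
HB.instance Definition _ := gen_choiceMixin (subfunctor F).
HB.instance Definition _ := Order.Le_isPOrder.Build (Order.Disp tt tt) (subfunctor F)
  sub_le_refl sub_le_anti sub_le_trans.

End Orders.

(* Both maps are required to be monotone: a monotone bijection need not be an
   isomorphism of posets. *)
Definition poset_iso d d' (S : porderType d) (T : porderType d') (f : S -> T) :=
  exists g : T -> S,
    [/\ cancel f g, cancel g f,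
        {homo f : x y / (x <= y)%O} & {homo g : x y / (x <= y)%O}].

Definition Psi (C : monoidal) (J : TId C) : subfunctor (representable (@unit1 C)) :=
  @Subfunctor C (representable 𝟙) (fun X => J 𝟙 X)
    (fun X => ideal_zmod J 𝟙 X)
    (fun X Y f x => @ideal_compl C J 𝟙 X Y f x).

(* Main.v *)
From mathcomp Require Import all_boot all_order all_algebra.
From mathcomp Require Import boolp classical_sets.
Require Import Defs.

(** A left-tensor ideal is recovered from its morphisms out
    of the unit, because in a right rigid category every [f : X -> Y] has a mate
    [(1 ⊠ f) ∘ co] from [𝟙] to [X^∨ ⊗ Y], and the triangle identity rebuilds
    [f] from its mate by tensoring on the left with [X] and composing with
    fixed morphisms ([mate_retract]).  Both passages stay inside a left-tensor
    ideal, so [f] belongs to it if and only if its mate does.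

    To invert [Psi], a subfunctor [M] of [C(𝟙, -)] is sent to the set [mates_in M]
    of all [f] such that [(1_Z ⊠ f) ∘ h] lies in [M] for every object [Z] and
    every [h : 𝟙 -> Z ⊗ X].  Testing against all [h], instead of only against
    the coevaluation of a chosen dual, makes this visibly a left-tensor ideal.
    What has to be proved is that its morphisms out of the unit are exactly [M].
    Taking [Z = 𝟙] shows that they lie in [M]; conversely, for [f : 𝟙 -> Y] the
    composite [(1_Z ⊠ f) ∘ h] is [g ∘ f] for some [g : Y -> Z ⊗ Y]
    ([tens_unit_factor]), by the interchange law, so it lies in [M] as soon as
    [f] does. *)

Set Implicit Arguments.
Unset Strict Implicit.
Unset Printing Implicit Defensive.

Import Order.TTheory GRing.Theory.
Local Open Scope ring_scope.
Local Open Scope classical_set_scope.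
Local Open Scope cat_scope.

Section TensorCalculus.
Variable C : monoidal.

Lemma mcomp_subr (X Y Z : C) (f g : mor Y Z) (h : mor X Y) :
  (f - g) ∘ h = f ∘ h - g ∘ h.
Proof. by apply: (addIr (g ∘ h)); rewrite -mcompDl !subrK. Qed.

Lemma tensm_subr (X Y Z W : C) (k : mor X Y) (f g : mor Z W) :
  k ⊠ (f - g) = k ⊠ f - k ⊠ g.
Proof. by apply: (addIr (k ⊠ g)); rewrite -tensmDr !subrK. Qed.

Lemma idm_tensM (W X Y Z : C) (g : mor Y Z) (f : mor X Y) :
  idm W ⊠ (g ∘ f) = (idm W ⊠ g) ∘ (idm W ⊠ f).
Proof. by rewrite -tensmM mcomp1m. Qed.

Lemma interchange (X X' Y Y' : C) (h : mor X X') (f : mor Y Y') :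
  (idm X' ⊠ f) ∘ (h ⊠ idm Y) = (h ⊠ idm Y') ∘ (idm X ⊠ f).
Proof. by rewrite -!tensmM !mcomp1m !mcompm1. Qed.

Lemma luniti_nat (X Y : C) (f : mor X Y) :
  (idm 𝟙 ⊠ f) ∘ luniti X = luniti Y ∘ f.
Proof.
by rewrite -[LHS]mcomp1m -lunitK -!mcompA (mcompA (lunit Y)) lunit_nat
           -(mcompA f) lunitiK mcompm1.
Qed.

Lemma associ_nat (X X' Y Y' Z Z' : C)
    (f : mor X X') (g : mor Y Y') (h : mor Z Z') :
  associ X' Y' Z' ∘ (f ⊠ (g ⊠ h)) = ((f ⊠ g) ⊠ h) ∘ associ X Y Z.
Proof.
by rewrite -[RHS]mcomp1m -assocK -!mcompA (mcompA (assoc X' Y' Z')) assoc_nat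
           -(mcompA (f ⊠ (g ⊠ h))) associK mcompm1.
Qed.

(** The constraints [lunit 𝟙] and [runit 𝟙] both identify [𝟙 ⊗ 𝟙] with [𝟙].
    The right one is forced in the witness by naturality, the left one is wanted
    in the conclusion; conjugating by both avoids the coherence theorem that
    they are equal. *)
Lemma unit_tens_factor (Z : C) (h : mor 𝟙 (Z ⊗ 𝟙)) :
  exists k : mor 𝟙 Z, h = (k ⊠ idm 𝟙) ∘ luniti 𝟙.
Proof.
exists (runit Z ∘ h ∘ lunit 𝟙 ∘ runiti 𝟙).
set k := (X in X ⊠ _).
have -> : k ⊠ idm 𝟙 = h ∘ lunit 𝟙.
  rewrite -[LHS]mcomp1m -runitK -mcompA runit_nat /k -!mcompA runitK mcompm1.
  by rewrite mcompA runitK mcomp1m.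
by rewrite -mcompA lunitiK mcompm1.
Qed.

(** Once [h] is written as [k ⊠ 1] with [k : 𝟙 -> Z], the interchange law moves
    [f] past it to the source, where it is the first morphism applied. *)
Lemma tens_unit_factor (Y Z : C) (f : mor 𝟙 Y) (h : mor 𝟙 (Z ⊗ 𝟙)) :
  exists g : mor Y (Z ⊗ Y), (idm Z ⊠ f) ∘ h = g ∘ f.
Proof.
have [k ->] := unit_tens_factor h.
by exists ((k ⊠ idm Y) ∘ luniti Y); rewrite mcompA interchange -!mcompA luniti_nat.
Qed.

(** Naturality of the constraints pulls [f] out of the triangle identity. *)
Lemma mate_retract (X Y : C) (D : right_dual X) (f : mor X Y) :
  lunit Y ∘ (ev D ⊠ idm Y) ∘ associ X (dual D) Y
    ∘ (idm X ⊠ ((idm (dual D) ⊠ f) ∘ co D)) ∘ runiti X = f.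
Proof.
rewrite idm_tensM -[RHS]mcompm1 -[in RHS](ev_co D) !mcompA.
congr (_ ∘ _ ∘ _).
by rewrite -lunit_nat -(mcompA _ (associ _ _ _)) associ_nat tensm1 mcompA
           -(mcompA (lunit Y) (ev D ⊠ _)) -interchange mcompA.
Qed.

End TensorCalculus.

Section MatesIdeal.
Variables (C : monoidal) (M : subfunctor (representable (@unit1 C))).

(** This is the largest left-tensor ideal whose morphisms out of [𝟙] all lie
    in [M]; the composites tested are the mates of [f] with respect to arbitrary
    [h], in place of a coevaluation. *)
Definition mates_in (X Y : C) : set (mor X Y) :=
  [set f | forall (Z : C) (h : mor 𝟙 (Z ⊗ X)), M (Z ⊗ Y) ((idm Z ⊠ f) ∘ h)].

Lemma mates_in_zmod (X Y : C) : zmod_closed [in @mates_in X Y].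
Proof.
split=> [|f g /set_mem fM /set_mem gM]; apply/mem_set => Z h.
  rewrite -(subrr 0) tensm_subr mcomp_subr subrr.
  by apply/set_mem; case: (sub_zmod M (Z ⊗ Y)).
rewrite tensm_subr mcomp_subr; apply/set_mem.
by case: (sub_zmod M (Z ⊗ Y)) => _; apply; apply/mem_set; [apply: fM|apply: gM].
Qed.

Lemma mates_in_compl (X Y Z : C) (g : mor Y Z) (f : mor X Y) :
  mates_in f -> mates_in (g ∘ f).
Proof.
move=> fM W h; rewrite idm_tensM -mcompA.
exact: (sub_fmap (idm W ⊠ g) (fM W h)).
Qed.

Lemma mates_in_compr (X Y Z : C) (f : mor Y Z) (h : mor X Y) :
  mates_in f -> mates_in (f ∘ h).
Proof. by move=> fM W k; rewrite idm_tensM -mcompA; apply: fM. Qed.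

(** A test of [1_Z ⊠ f] with the object [W] is, up to associativity, a test
    of [f] with [W ⊗ Z]. *)
Lemma mates_in_tens (X Y Z : C) (f : mor X Y) :
  mates_in f -> mates_in (idm Z ⊠ f).
Proof.
move=> fM W h.
have -> : (idm W ⊠ (idm Z ⊠ f)) ∘ h =
    assoc W Z Y ∘ ((idm (W ⊗ Z) ⊠ f) ∘ (associ W Z X ∘ h)).
  by rewrite -tensm1 (mcompA _ (associ _ _ _)) -associ_nat !mcompA associK
             mcomp1m.
exact: (sub_fmap (assoc W Z Y) (fM _ (associ W Z X ∘ h))).
Qed.

Definition mates_ideal : TId C :=
  LeftTensorIdeal
    (tid_ideal := Ideal mates_in_zmod mates_in_compl mates_in_compr)
    mates_in_tens.

(** From left to right, the test with [Z = 𝟙] and [h = luniti 𝟙] already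
    suffices. *)
Lemma mates_in_unit (Y : C) (f : mor 𝟙 Y) : mates_in f <-> M Y f.
Proof.
split=> [fM|fM Z h]; last first.
  have [g ->] := tens_unit_factor f h.
  exact: (sub_fmap g fM).
have := sub_fmap (lunit Y) (fM 𝟙 (luniti 𝟙)).
by rewrite /= /postcomp luniti_nat mcompA lunitiK mcomp1m.
Qed.

End MatesIdeal.

(** This is where rigidity enters: it makes a left-tensor ideal depend only on
    its morphisms out of the unit. *)
Lemma tid_mate (C : monoidal) (J : TId C) (X Y : C) (D : right_dual X)
    (f : mor X Y) :
  J _ _ ((idm (dual D) ⊠ f) ∘ co D) -> J X Y f.
Proof.
move=> fJ; rewrite -(mate_retract D f); apply: ideal_compr.
by apply: ideal_compl; apply: tid_tens.
Qed.

Theorem theorem3p1p1 (C : monoidal) (C_rigid : right_rigid C) :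
  poset_iso (@Psi C).
Proof.
exists (@mates_ideal C); split=> [J|M|I J /asboolP IJ|M N /asboolP MN].
- apply/le_anti/andP; split; apply/asboolP => X Y f fJ.
    have [D] := C_rigid X.
    exact: tid_mate (fJ _ (co D)).
  by move=> Z h; apply: ideal_compr; apply: tid_tens.
- by apply/le_anti/andP; split; apply/asboolP => Y f /mates_in_unit.
- by apply/asboolP => Y; apply: IJ.
- by apply/asboolP => X Y f fM Z h; apply/MN/fM.
Qed.
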